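(* Let $M$ be positive semidefinite and suppose $S=\emptyset$, i.e., $\bar u_i>0$ for all $i\in[n]$. Consider the uncertain LCP $$0\le z(u)\perp Mz(u)+q(u)\ge 0\quad\text{for all } u\in\mathcal{U}.$$ (a) If there are multiple solutions to the nominal LCP$(\bar q,M)$, then there is no AAR solution. (b) If there exists an AAR solution, it is unique.
   Context: Notation: $[n]=\{1,\dots,n\}$ and $[h]=\{1,\dots,h\}$ ($[0]=\emptyset$). For a matrix $A$ and an index set $I$, $A_{I,\cdot}$ and $A_{\cdot,I}$ denote the submatrices formed by the rows, respectively columns, indexed by $I$. Vector inequalities are componentwise, and $0\le a\perp b\ge 0$ means $a\ge0$, $b\ge0$, $a^\top b=0$. A (not necessarily symmetric) matrix $M\in\mathbb{R}^{n\times n}$ is positive semidefinite if $x^\top Mx\ge0$ for all $x\in\mathbb{R}^n$. Data: $M\in\mathbb{R}^{n\times n}$, $\bar q\in\mathbb{R}^n$, $\bar u\in\mathbb{R}^n_{\ge0}$, $h\in\{0,\dots,n\}$. The uncertainty set is the box $\mathcal{U}=\{u\in\mathbb{R}^n: -\bar u_i\le u_i\le \bar u_i,\ i\in[n]\}$, and $q(u)=\bar q+u$ for $u\in\mathcal{U}$. Let $S=\{i\in[n]:\bar u_i=0\}$. LCP$(\bar q,M)$ is the problem of finding $z\in\mathbb{R}^n$ with $0\le z\perp Mz+\bar q\ge0$. An affinely adjustable robust (AAR) solution of the uncertain LCP is an affine function $z(u)=Du+r$ with $D\in\mathbb{R}^{n\times n}$, $r\in\mathbb{R}^n$, $D_{[h],\cdot}=0$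 (the first $h$ variables are non-adjustable) and, by convention, $D_{\cdot,S}=0$, such that $0\le z(u)\perp Mz(u)+q(u)\ge0$ for all $u\in\mathcal{U}$. *)

(* Defs.v *)
From mathcomp Require Import all_boot all_order all_algebra.
From mathcomp Require Import reals.

Set Implicit Arguments.
Unset Strict Implicit.
Unset Printing Implicit Defensive.

Import Order.TTheory GRing.Theory Num.Theory.
Local Open Scope ring_scope.

Definition nonneg (R : realType) (n : nat) (a : 'cV[R]_n) : Prop :=
  forall i, 0 <= a i 0.

(* 0 <= a _|_ b >= 0 *)
Definition complementary (R : realType) (n : nat) (a b : 'cV[R]_n) : Prop :=
  [/\ nonneg a, nonneg b & (a^T *m b) 0 0 = 0].

(* M is not assumed to be symmetric. *)
Definition psd (R : realType) (n : nat) (M : 'M[R]_n) : Prop :=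
  forall x : 'cV[R]_n, 0 <= (x^T *m M *m x) 0 0.

Definition LCP_solution (R : realType) (n : nat) (q : 'cV[R]_n) (M : 'M[R]_n)
    (z : 'cV[R]_n) : Prop :=
  complementary z (M *m z + q).

Definition uncertainty_box (R : realType) (n : nat) (ubar u : 'cV[R]_n) : Prop :=
  forall i, - ubar i 0 <= u i 0 <= ubar i 0.

Definition certain_indices (R : realType) (n : nat) (ubar : 'cV[R]_n) :
    {set 'I_n} :=
  [set i | ubar i 0 == 0].

Definition affine_eval (R : realType) (n : nat) (z : 'M[R]_n * 'cV[R]_n)
    (u : 'cV[R]_n) : 'cV[R]_n :=
  z.1 *m u + z.2.

(* The pair z = (D, r) encodes the affine function u |-> D u + r on R^n, which
   determines D and r. Indices start at 0, so the first h variables, which are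
   non-adjustable, are those with index i < h. *)
Definition AAR_solution (R : realType) (n : nat) (M : 'M[R]_n)
    (qbar ubar : 'cV[R]_n) (h : nat) (z : 'M[R]_n * 'cV[R]_n) : Prop :=
  [/\ forall i j : 'I_n, (i < h)%N -> z.1 i j = 0,
      forall i j : 'I_n, j \in certain_indices ubar -> z.1 i j = 0
    & forall u : 'cV[R]_n, uncertainty_box ubar u ->
        LCP_solution (qbar + u) M (affine_eval z u)].

(* Main.v *)
(** Monotonicity of [M] gives [(z - z')^T (q - q') <= 0] for any solutions [z] of
    LCP(q, M) and [z'] of LCP(q', M). Suppose [v |-> D v + r] solves LCP(q + v, M)
    for all [v] in a box with nonempty interior around [0], and [z'] solves
    LCP(q, M). With [d = r - z'] and [v = t d], this reads
    [t^2 d^T D^T d + t d^T d <= 0], and letting [t] decrease to [0] yields [d = 0].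
    This is (a); applied around every point [u] of the half-size box it shows
    that two AAR solutions agree there, which is (b). *)
Require Import Defs.
From mathcomp Require Import all_boot all_order all_algebra.
From mathcomp Require Import reals.
From mathcomp Require Import lra.

Set Implicit Arguments.
Unset Strict Implicit.

Import Order.TTheory GRing.Theory Num.Theory.
Local Open Scope ring_scope.

Lemma dot_ge0 (R : realType) (n : nat) (a b : 'cV[R]_n) :
  nonneg a -> nonneg b -> 0 <= (a^T *m b) 0 0.
Proof.
move=> a_ge0 b_ge0; rewrite mxE sumr_ge0// => i _.
by rewrite mxE mulr_ge0.
Qed.

Lemma dot_self_le0 (R : realType) (n : nat) (a : 'cV[R]_n) :
  (a^T *m a) 0 0 <= 0 -> a = 0.
Proof.
have sq_ge0 (i : 'I_n) : true -> 0 <= a^T 0 i * a i 0.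
  by rewrite mxE -expr2 sqr_ge0.
move=> a_le0; have : \sum_i a^T 0 i * a i 0 == 0.
  by rewrite eq_le sumr_ge0// andbT; move: a_le0; rewrite mxE.
rewrite psumr_eq0// => /allP a0; apply/colP => i.
have := a0 i (mem_index_enum i).
by rewrite !mxE mulf_eq0 orbb => /eqP.
Qed.

(** With [w_i = M z_i + q_i], complementarity leaves [(z1 - z2)^T (w1 - w2) = - z1^T w2 - z2^T w1 <=
    0]. Since [w1 - w2 = M (z1 - z2) + (q1 - q2)] and [M] contributes a nonnegative quadratic form,
    the [q] part is at most 0. *)
Lemma LCP_solution_monotone (R : realType) (n : nat) (M : 'M[R]_n)
    (q1 q2 z1 z2 : 'cV[R]_n) :
  psd M -> LCP_solution q1 M z1 -> LCP_solution q2 M z2 ->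
  ((z1 - z2)^T *m (q1 - q2)) 0 0 <= 0.
Proof.
move=> M_psd [z1_ge0 w1_ge0 zw1] [z2_ge0 w2_ge0 zw2].
have entryD (A B : 'M[R]_1) : (A + B) 0 0 = A 0 0 + B 0 0 by rewrite mxE.
have entryN (A : 'M[R]_1) : (- A) 0 0 = - A 0 0 by rewrite mxE.
have := dot_ge0 z2_ge0 w1_ge0; have := dot_ge0 z1_ge0 w2_ge0.
have := M_psd (z1 - z2); move: zw1 zw2.
rewrite -mulmxA !linearB /= !(mulmxBl, mulmxBr, mulmxDr) !(entryD, entryN).
lra.
Qed.

Lemma box_absorbing (R : realType) (n : nat) (ubar x : 'cV[R]_n) :
  (forall i, 0 < ubar i 0) ->
  exists2 c : R, 0 < c &
    forall t : R, 0 <= t <= c -> uncertainty_box ubar (t *: x).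
Proof.
move=> ubar_gt0.
have quot_ge0 i : 0 <= `|x i 0| / ubar i 0 by rewrite divr_ge0// ltW.
(* [s] dominates every ratio [|x_i| / ubar_i], so [c = 1 / s] works; the summand 1 keeps [s]
   positive when [x = 0]. *)
pose s := 1 + \sum_i `|x i 0| / ubar i 0.
have s_gt0 : 0 < s by rewrite ltr_pwDl// sumr_ge0.
exists s^-1; first by rewrite invr_gt0.
move=> t /andP[t_ge0 t_le] i; rewrite -ler_norml mxE normrM ger0_norm//.
apply: (le_trans (ler_wpM2r (normr_ge0 _) t_le)).
rewrite mulrC ler_pdivrMr// -ler_pdivrMl// mulrC /s (bigD1 i)//=.
by rewrite addrCA lerDl addr_ge0// sumr_ge0.
Qed.

(** Performs the limit [t -> 0] algebraically, by testing one well-chosen [t]. *)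
Lemma le0_of_small_multiples (R : realFieldType) (a b c : R) :
  0 < c -> (forall t, 0 < t <= c -> a <= t * b) -> a <= 0.
Proof.
move=> c_gt0 small; case: (leP a 0) => // a_gt0.
have b_gt0 : 0 < b.
  by rewrite -(pmulr_rgt0 _ c_gt0) (lt_le_trans a_gt0)// small// c_gt0 lexx.
have den_gt0 : 0 < a + c * b by rewrite addr_gt0// mulr_gt0.
(* This [t = c a / (a + c b)] lies in [(0, c]], yet [t b < a] because [c b < a + c b]. *)
have : a <= c * a / (a + c * b) * b.
  apply: small; rewrite divr_gt0 ?mulr_gt0//= ler_pdivrMr// ler_pM2l//.
  by rewrite lerDl ltW// mulr_gt0.
by rewrite mulrAC ler_pdivlMr//; nra.
Qed.

Lemma affine_solution_unique_at_center (R : realType) (n : nat)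
    (M D : 'M[R]_n) (q ubar r z : 'cV[R]_n) :
  psd M -> (forall i, 0 < ubar i 0) ->
  (forall v, uncertainty_box ubar v -> LCP_solution (q + v) M (D *m v + r)) ->
  LCP_solution q M z -> z = r.
Proof.
move=> M_psd ubar_gt0 aff_sol z_sol; pose d := r - z.
suff d0 : d = 0 by apply/esym/eqP; rewrite -subr_eq0 -/d d0.
apply: dot_self_le0.
have [c c_gt0 in_box] := box_absorbing d ubar_gt0.
(* Monotonicity at [v = t d], divided by [t > 0], reads [d^T d <= - t (D d)^T d]. *)
apply: (@le0_of_small_multiples _ _ (- ((D *m d)^T *m d) 0 0) c) => // t.
move=> /andP[t_gt0 t_le].
have td_box : uncertainty_box ubar (t *: d).
  by apply: in_box; rewrite (ltW t_gt0).
have := LCP_solution_monotone M_psd (aff_sol _ td_box) z_sol.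
have -> : D *m (t *: d) + r - z = t *: (D *m d) + d.
  by rewrite -scalemxAr -addrA.
rewrite [q + _]addrC addrK -scalemxAr mxE pmulr_rle0//.
have -> : (t *: (D *m d) + d)^T = t *: (D *m d)^T + d^T.
  by rewrite linearD linearZ.
rewrite mulmxDl -scalemxAl.
by rewrite mxE [X in X + _]mxE mulrN; lra.
Qed.

Lemma AAR_solution_eq (R : realType) (n : nat) (M : 'M[R]_n)
    (qbar ubar : 'cV[R]_n) (h : nat) (z z' : 'M[R]_n * 'cV[R]_n) :
  psd M -> (forall i, 0 < ubar i 0) ->
  AAR_solution M qbar ubar h z -> AAR_solution M qbar ubar h z' -> z = z'.
Proof.
case: z z' => [D r] [D' r'] M_psd ubar_gt0 [_ _ sol] [_ _ sol'].
pose half := 2^-1 *: ubar.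
have half_gt0 i : 0 < half i 0 by rewrite mxE mulr_gt0// invr_gt0.
have half_box u v : uncertainty_box half u -> uncertainty_box half v ->
    uncertainty_box ubar (u + v).
  move=> u_in v_in i; move: (u_in i) (v_in i); rewrite !mxE.
  by move=> /andP[? ?] /andP[? ?]; apply/andP; split; lra.
have box0 : uncertainty_box half 0.
  by move=> i; rewrite [(0 : 'cV_n) i 0]mxE oppr_le0 ltW.
have agree u : uncertainty_box half u -> D' *m u + r' = D *m u + r.
  move=> u_in.
  (* Recentred at [u], the first solution is [v |-> D v + (D u + r)] on the half box; [D' u + r']
     solves the problem at its centre. *)
  apply: (@affine_solution_unique_at_center _ _ M D (qbar + u) half) => //.
    move=> v v_in.
    have -> : D *m v + (D *m u + r) = D *m (u + v) + r.
      by rewrite mulmxDr addrA [D *m v + _]addrC.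
    by rewrite -addrA; exact: sol (half_box _ _ u_in v_in).
  by apply: sol'; rewrite -[u]addr0; apply: half_box.
have r_eq : r' = r by have := agree 0 box0; rewrite !mulmx0 !add0r.
congr (_, _) => //; apply/matrixP => i j.
(* With equal constant terms, agreement at a small multiple of the [j]-th unit vector identifies
   column [j] of [D] and [D']. *)
have [c c_gt0 in_box] := box_absorbing (delta_mx j 0 : 'cV[R]_n) half_gt0.
have /agree : uncertainty_box half (c *: delta_mx j 0).
  by apply: in_box; rewrite ltW/=.
rewrite r_eq => /addIr; rewrite -!scalemxAr -!colE => /colP/(_ i).
by rewrite !mxE => /(mulfI (lt0r_neq0 c_gt0)).
Qed.

Theorem theorem4 (R : realType) (n : nat) (M : 'M[R]_n) (qbar ubar : 'cV[R]_n)
    (h : nat) (ubar_ge0 : nonneg ubar) (h_le_n : (h <= n)%N)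
    (M_psd : psd M) (S_empty : certain_indices ubar = set0) :
  ((exists z1 z2 : 'cV[R]_n,
      [/\ LCP_solution qbar M z1, LCP_solution qbar M z2 & z1 <> z2]) ->
    ~ exists z : 'M[R]_n * 'cV[R]_n, AAR_solution M qbar ubar h z)
  /\
  ((exists z : 'M[R]_n * 'cV[R]_n, AAR_solution M qbar ubar h z) ->
    exists! z : 'M[R]_n * 'cV[R]_n, AAR_solution M qbar ubar h z).
Proof.
have ubar_gt0 i : 0 < ubar i 0.
  rewrite lt_def ubar_ge0 andbT.
  by have /setP/(_ i) := S_empty; rewrite !inE => ->.
split=> [[z1 [z2 [sol1 sol2 z12]]] [[D r] [_ _ sol]] | [z z_sol]].
  (* Every nominal solution must equal [r], the value of the AAR solution at the centre [u = 0]. *)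
  have eq_r y : LCP_solution qbar M y -> y = r.
    exact: affine_solution_unique_at_center M_psd ubar_gt0 sol.
  by apply: z12; rewrite (eq_r _ sol1) (eq_r _ sol2).
exists z; split=> // z' z'_sol; exact: AAR_solution_eq M_psd ubar_gt0 z_sol z'_sol.
Qed.
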